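(* Let $G$ be an infinite group with identity $e$ and let $A\subseteq G$ satisfy $A=A^{-1}$ and $e\in A$. Then there exists a subset $X\subseteq G$ such that $\Delta(X)=A$.
   Context: For $X\subseteq G$, $\Delta(X)=\{g\in G:|gX\cap X|=\infty\}$. *)

(* Defs.v *)
From mathcomp Require Import all_boot.
From mathcomp Require Import boolp classical_sets cardinality.

Set Implicit Arguments.
Unset Strict Implicit.
Unset Printing Implicit Defensive.

Local Open Scope classical_set_scope.
Local Open Scope group_scope.

(* [groupType] is the type of arbitrary (possibly infinite) groups. Its
   [choiceType] component is no restriction in the classical setting. *)

Definition translate (G : groupType) (g : G) (X : set G) : set G :=
  [set g * x | x in X].

Definition set_inv (G : groupType) (A : set G) : set G :=
  [set a^-1 | a in A].

Definition Delta (G : groupType) (X : set G) : set G :=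
  [set g | infinite_set (translate g X `&` X)].

(* Main.v *)
Require Import Defs.
From Stdlib Require Import Inverse_Image.
From mathcomp Require Import all_boot.
From mathcomp Require Import boolp classical_sets functions cardinality wochoice.

(** Well-order [G] so that all initial segments have cardinality smaller than [G],
    and fix [g : G -> A] with all fibers infinite (possible as [|G x nat| = |G|]).
    By transfinite recursion choose [f i] such that neither [f i] nor [g i * f i]
    is of the form [u * v^-1 * y] with [u], [v], [y] among the [f j] and
    [g j * f j], [j < i]; there are fewer than [|G|] values to avoid because
    [k * k = k] for infinite cardinals. Let [X] be the set of all [f i] and
    [g i * f i]. Each [a] in [A] is the quotient of [g i * f i] by [f i] for
    infinitely many [i], while a quotient outside [A] relates elements of
    different stages and, by genericity, can appear at one stage only, hence
    finitely often. *)

Local Open Scope classical_set_scope.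
Local Open Scope card_scope.

(** * Cardinal comparison by injections *)

Lemma card_le_inj {T U : Type} {A : set T} {B : set U} (f : T -> U) :
    {homo f : x / A x >-> B x} ->
    (forall x y, A x -> A y -> f x = f y -> x = y) ->
  A #<= B.
Proof.
move=> fAB f_inj.
have /card_eqPle[_ leA] : f @` A #= A.
  by apply: inj_card_eq => x y /set_mem Ax /set_mem Ay; apply: f_inj.
by apply: (card_le_trans leA); apply: subset_card_le => _ [x Ax <-]; apply: fAB.
Qed.

(** Trades a map between subtypes for a total function; [u0] is a junk value taken outside [A]. *)
Lemma card_le_ex_inj {T U : Type} {A : set T} {B : set U} (u0 : U) :
  A #<= B -> exists f : T -> U, {homo f : x / A x >-> B x} /\
    (forall x y, A x -> A y -> f x = f y -> x = y).
Proof.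
move=> /card_leP[F].
exists (fun x => if pselect (A x) is left Ax then set_val (F (SigSub (mem_set Ax))) else u0).
split=> [x Ax|x y Ax Ay].
  by case: pselect => // Ax'; apply: set_valP.
case: pselect => // Ax'; case: pselect => // Ay' /val_inj.
by move=> /(inj (mem_set I) (mem_set I)) [].
Qed.

Lemma card_le_setX {T T' U U' : Type} {A : set T} {A' : set T'}
    {B : set U} {B' : set U'} :
  A #<= B -> A' #<= B' -> A `*` A' #<= B `*` B'.
Proof.
move=> AB AB'.
have [->|/set0P[[x x'] [/= Ax Ax']]] := eqVneq (A `*` A') set0; first exact: card_ge0.
have [/card_leP[F] /card_leP[F']] := (AB, AB').
have [f [fB f_inj]] := card_le_ex_inj (set_val (F (SigSub (mem_set Ax)))) AB.
have [f' [fB' f_inj']] := card_le_ex_inj (set_val (F' (SigSub (mem_set Ax')))) AB'.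
apply: (card_le_inj (fun p => (f p.1, f' p.2))) => [[a a'] [/= Aa Aa']|].
  by split; [apply: fB | apply: fB'].
by move=> [a a'] [b b'] [/= Aa Aa'] [/= Ab Ab'] [/f_inj-> // /f_inj'->].
Qed.

(** * Well-orders and transfinite recursion *)

Lemma ex_wf_trichotomy (T : eqType) : exists lt : T -> T -> Prop,
  [/\ well_founded lt, forall x y z, lt x y -> lt y z -> lt x z &
      forall x y, [\/ lt x y, x = y | lt y x]].
Proof.
have [R R_wo] := well_ordering_principle T.
have R_wo' : wo_chain R predT by move=> A _; apply: R_wo.
have Rtot x y : R x y || R y x by apply: (wo_chainW R_wo').
have Ranti x y : R x y -> R y x -> x = y.
  by move=> xy yx; apply: (wo_chain_antisymmetric R_wo'); rewrite ?xy.
have ltW x y : ~~ R y x -> R x y by have := Rtot x y; case: (R y x); rewrite ?orbF.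
exists (fun x y => ~~ R y x); split.
- move=> x; apply: contrapT => x_nacc.
  (* A least inaccessible point has only accessible predecessors, hence is accessible. *)
  have [|m [[/asboolP m_nacc m_min] _]] := R_wo [pred y | `[< ~ Acc (fun x y => ~~ R y x) y >]].
    by exists x; apply/asboolP.
  apply: m_nacc; constructor => y; apply: contraNP => y_nacc.
  by apply: m_min; apply/asboolP.
- move=> x y z xy yz.
  have [|m [[]]] := R_wo (mem [:: x; y; z]); first by exists x; rewrite inE eqxx.
  rewrite !inE => /or3P[] /eqP -> m_min _.
  + apply/negP => zx; have xz : R x z by apply: m_min; rewrite !inE eqxx !orbT.
    by move: yz; rewrite -(Ranti _ _ xz zx) (ltW _ _ xy).
  + by case/negP: xy; apply: m_min; rewrite !inE eqxx.
  + by case/negP: yz; apply: m_min; rewrite !inE eqxx !orbT.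
- move=> x y; have [xy|] := boolP (R x y); last by constructor 3.
  have [yx|] := boolP (R y x); last by constructor 1.
  by constructor 2; apply: Ranti.
Qed.

(** Transfinite recursion with choice: [P i f] reads [f] only below [i], so the part built so far
    may be padded with [x0]. *)
Lemma wf_pick {I T : Type} (lt : I -> I -> Prop) (P : I -> (I -> T) -> T -> Prop) (x0 : T) :
    well_founded lt ->
    (forall i f f', (forall j, lt j i -> f j = f' j) -> P i f `<=` P i f') ->
    (forall i f, exists x, P i f x) ->
  exists f, forall i, P i f (f i).
Proof.
move=> wf Ploc Pex.
have [c cP] := boolp.choice (fun p : I * (I -> T) => Pex p.1 p.2).
pose ext i (r : forall j, lt j i -> T) j := if pselect (lt j i) is left h then r j h else x0.
pose F := Fix wf (fun=> T) (fun i r => c (i, ext i r)).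
have FE i : F i = c (i, ext i (fun j _ => F j)).
  rewrite /F Fix_eq // => k r r' rr'; congr (c (_, _)).
  by apply: funext => j; rewrite /ext; case: pselect.
exists F => i; rewrite [X in P i F X]FE.
apply: (Ploc i (ext i (fun j _ => F j))) (cP (i, _)) => j ji.
by rewrite /ext; case: pselect.
Qed.

(** * Infinite cardinals equal their squares *)

Lemma card_le_setX_bool {T : Type} {A : set T} :
  infinite_set A -> A `*` [set: bool] #<= A `*` A.
Proof.
move=> Ainf; apply: card_le_setX; first exact: card_lexx.
have bool_nat : [set: bool] #<= [set: nat] by apply: countableP.
by apply: (card_le_trans bool_nat); apply/infiniteP.
Qed.

Section SquareStep.
Context {T : eqType} {lt : T -> T -> Prop}.
Hypotheses (lt_wf : well_founded lt)
  (lt_trans : forall x y z, lt x y -> lt y z -> lt x z)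
  (lt_tri : forall x y, [\/ lt x y, x = y | lt y x]).

(* Goedel's ordering of the square: by maximum, then lexicographically. *)
Let mx (p : T * T) := if pselect (lt p.1 p.2) then p.2 else p.1.

Let ltX (p q : T * T) := lt (mx p) (mx q) \/ mx p = mx q /\
  (lt p.1 q.1 \/ p.1 = q.1 /\ lt p.2 q.2).

(** Nested induction on the maximum, then the first, then the second coordinate. *)
Let ltX_wf : well_founded ltX.
Proof.
suff accX m x y : mx (x, y) = m -> Acc ltX (x, y) by case=> x y; apply: (accX _ _ _ erefl).
elim/(well_founded_ind lt_wf): m x y => m IHm x.
elim/(well_founded_ind lt_wf): x => x IHx y.
elim/(well_founded_ind lt_wf): y => y IHy mxy.
constructor => -[x' y'] [|[]] /=; rewrite mxy; first by move=> /IHm/(_ _ _ erefl).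
move=> mxy' [/IHx/(_ _ mxy')//|[xx']].
by rewrite xx' in mxy' * => /IHy/(_ mxy').
Qed.

Let ltX_total p q : p <> q -> ltX p q \/ ltX q p.
Proof.
case: p q => [x y] [x' y'] neq; rewrite /ltX /=.
have [|->|] := lt_tri (mx (x, y)) (mx (x', y')); [by left; left| |by right; left].
have [|exx|] := lt_tri x x'; [by left; right; split; [|left]| |by right; right; split; [|left]].
have [|eyy|] := lt_tri y y'; [by left; right; split; [|right]| |by right; right; split; [|right]].
by case: neq; rewrite exx eyy.
Qed.

Let ltX_mx p q : ltX p q -> forall x, x = p.1 \/ x = p.2 -> x = mx q \/ lt x (mx q).
Proof.
move=> pq x xp.
have le_xp : x = mx p \/ lt x (mx p).
  rewrite /mx; case: pselect => /= p12; case: xp => ->; [by right|by left|by left|].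
  by have [//|->|] := lt_tri p.1 p.2; [left|right].
case: pq => [pq|[<- _] //]; right.
by case: le_xp => [->//|/lt_trans]; apply.
Qed.

(** Each pair has fewer than [|D|] predecessors in Goedel's order, so an injection of the square
    into [D] can be chosen greedily along it. *)
Lemma card_le_square_step (D : set T) : infinite_set D ->
    (forall t, D t -> ~ (D #<= D `&` [set u | lt u t])) ->
    (forall t, D t -> infinite_set (D `&` [set u | lt u t]) ->
      (D `&` [set u | lt u t]) `*` (D `&` [set u | lt u t]) #<= D `&` [set u | lt u t]) ->
  D `*` D #<= D.
Proof.
move=> Dinf Dsmall Dsq.
have [x0 Dx0] := infinite_setN0 Dinf.
have below_small p : (D `*` D) p -> ~ (D #<= (D `*` D) `&` [set q | ltX q p]).
  move=> [Dp1 Dp2]; set m := mx p; set S := D `&` [set u | lt u m].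
  have Dm : D m by rewrite /m /mx; case: pselect.
  (* The closed segment up to [m] contains both coordinates of every predecessor of [p]. *)
  pose L := m |` S.
  have sL : (D `*` D) `&` [set q | ltX q p] `<=` L `*` L.
    move=> [x y] [[/= Dx Dy] /ltX_mx xy]; split=> /=.
      by have [|->|] := xy x; [left|left|right].
    by have [|->|] := xy y; [right|left|right].
  move=> /card_le_trans/(_ (subset_card_le sL)) DL.
  have [Sfin|Sinf] := pselect (finite_set S).
    apply: Dinf; apply: (card_le_finite DL).
    by apply: finite_setX; rewrite /L finite_setU.
  apply: (Dsmall m) => //; apply: (card_le_trans DL).
  have LS : L #<= S.
    have [s Ss] := infinite_setN0 Sinf.
    (* One more point does not enlarge an infinite [S]: the flag [false] codes [m]. *)
    have LSb : L `<=` (fun q => if q.2 then q.1 else m) @` (S `*` [set: bool]).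
      move=> x [->|Sx]; first by exists (s, false).
      by exists (x, true).
    apply: (card_le_trans (subset_card_le LSb)).
    apply: (card_le_trans (card_image_le _ _)).
    exact: (card_le_trans (card_le_setX_bool Sinf) (Dsq _ Dm Sinf)).
  exact: (card_le_trans (card_le_setX LS LS) (Dsq _ Dm Sinf)).
have [||f fP] := @wf_pick _ _ ltX (fun p f x => (D `*` D) p ->
    D x /\ forall q, (D `*` D) q -> ltX q p -> f q <> x) x0 ltX_wf.
  - move=> p f f' ff' x /[apply] -[Dx fx]; split=> // q Dq qp; rewrite -ff' //.
    exact: fx.
  - move=> p f; have [Dp|] := pselect ((D `*` D) p); last by exists x0.
    have /existsNP[x /not_implyP[Dx nx]] :
        ~ D `<=` f @` ((D `*` D) `&` [set q | ltX q p]).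
      move=> /subset_card_le/card_le_trans/(_ (card_image_le _ _)).
      exact: below_small.
    exists x => _; split=> // q Dq qp fqx; apply: nx; by exists q.
apply: (card_le_inj f) => [p /fP[]//|p q Dp Dq fpq].
apply: contrapT => /ltX_total[pq|qp].
  by have [_ /(_ p Dp pq)] := fP q Dq.
by have [_ /(_ q Dq qp)] := fP p Dp; apply.
Qed.
End SquareStep.

Lemma card_le_square_setT (T : eqType) :
  infinite_set [set: T] -> [set: T] `*` [set: T] #<= [set: T].
Proof.
have [lt [lt_wf lt_trans lt_tri]] := ex_wf_trichotomy T.
pose seg t := [set u | lt u t].
have sq_of_segs (D : set T) : infinite_set D ->
    (forall t, D t -> seg t `<=` D) ->
    (forall t, D t -> infinite_set (seg t) -> seg t `*` seg t #<= seg t) ->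
  D `*` D #<= D.
  move=> Dinf Dseg Dsq.
  have DI t : D t -> D `&` seg t = seg t by move=> /Dseg /setIidr.
  (* Either [D] injects into one of its own segments, whose square is already bounded, or all of
     them are smaller than [D] and the greedy step applies. *)
  have [[t [Dt Dle]]|nDle] := pselect (exists t, D t /\ D #<= seg t).
    have segD := subset_card_le (Dseg _ Dt).
    apply: (card_le_trans (card_le_setX Dle Dle)).
    apply: (card_le_trans _ segD); apply: Dsq => //.
    by apply: contra_not Dinf; apply: card_le_finite.
  apply: (card_le_square_step lt_wf lt_trans lt_tri) => // t.
    by move=> Dt; rewrite DI // => ?; apply: nDle; exists t.
  by move=> Dt; rewrite DI //; apply: Dsq.
move=> Tinf; apply: (sq_of_segs setT) => // t _.
elim/(well_founded_ind lt_wf): t => t IH tinf; apply: (sq_of_segs (seg t)) => // s st.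
  by move=> u us; apply: lt_trans st.
Qed.

Lemma card_le_square (T : choiceType) (A : set T) : infinite_set A -> A `*` A #<= A.
Proof.
move=> Ainf; have /card_eqPle[TA AT] := card_setT A.
apply: (card_le_trans (card_le_setX AT AT)).
apply: (card_le_trans _ TA); apply: card_le_square_setT.
by apply: contra_not Ainf; apply: card_le_finite.
Qed.

(** * Initial well-orders and maps with infinite fibers *)

(** If some segment is as large as [T], take the least such [t] and pull the order back along an
    injection [e] of [T] into the segment below [t]. *)
Lemma ex_initial_order (T : eqType) : exists lt : T -> T -> Prop,
  [/\ well_founded lt, forall x y z, lt x y -> lt y z -> lt x z,
      forall x y, [\/ lt x y, x = y | lt y x] &
      forall x, ~ ([set: T] #<= [set y | lt y x])].
Proof.
have [lt [lt_wf lt_trans lt_tri]] := ex_wf_trichotomy T.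
have [[t tT]|nT] := pselect (exists t, [set: T] #<= [set y | lt y t]); last first.
  by exists lt; split=> // x Tx; apply: nT; exists x.
move: t tT; elim/(well_founded_ind lt_wf) => t IH tT.
have [[s [st sT]]|nT] := pselect (exists s, lt s t /\ [set: T] #<= [set y | lt y s]).
  exact: IH sT.
have [e [et /(_ _ _ I I) e_inj]] := card_le_ex_inj t tT.
exists (fun x y => lt (e x) (e y)); split.
- by move=> x; apply: (wf_inverse_image _ _ lt e lt_wf).
- by move=> x y z; apply: lt_trans.
- move=> x y; have [|/e_inj|] := lt_tri (e x) (e y); [by constructor 1|by constructor 2|by constructor 3].
- move=> x Tx; apply: nT; exists (e x); split; first exact: et.
  apply: (card_le_trans Tx); apply: (card_le_inj e) => // y z _ _; apply: e_inj.
Qed.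

(** With [e] injecting pairs from [A] and [nat] into [T], [g] sends [e (a, n)] to [a] and all other
    points to [a0]. *)
Lemma ex_infinite_fibers (T : choiceType) (A : set T) (a0 : T) :
    infinite_set [set: T] -> A a0 ->
  exists g : T -> T, (forall x, A (g x)) /\
    forall a, A a -> infinite_set (g @^-1` [set a]).
Proof.
move=> Tinf Aa0.
have natT : [set: nat] #<= [set: T] by apply/infiniteP.
have := card_le_trans (card_le_setX (card_leT A) natT) (card_le_square_setT _ Tinf).
move=> /(card_le_ex_inj a0)[e [_ e_inj]].
pose g x := if pselect (exists p, A p.1 /\ e p = x) is left h then (projT1 (cid h)).1 else a0.
have gA x : A (g x) by rewrite /g; case: pselect => // h; case: (cid h) => p [].
exists g; split=> // a Aa; apply/infiniteP; apply: (card_le_inj (fun n => e (a, n))).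
  move=> n _; rewrite /preimage /= /g; case: pselect => [h|[]]; last by exists (a, n).
  by case: (cid h) => p [/= Ap] /e_inj ->.
by move=> m n _ _ /(e_inj (a, m) (a, n) (conj Aa I) (conj Aa I)) [].
Qed.

(** * Counting forbidden values *)

(** Meant for [S] the set of earlier stages, each contributing two elements told apart by a flag. *)
Lemma card_nle_image_setX_bool (T : choiceType) (U V : Type) (S : set T) (D : set U)
    (F : T * bool -> V) : infinite_set D -> ~ (D #<= S) -> ~ (D #<= F @` (S `*` [set: bool])).
Proof.
move=> Dinf nDS DF; have {DF} DS := card_le_trans DF (card_image_le _ _).
have [Sfin|Sinf] := pselect (finite_set S).
  by apply: Dinf; apply: (card_le_finite DS); apply: finite_setX.
apply: nDS; apply: (card_le_trans DS).
exact: card_le_trans (card_le_setX_bool Sinf) (card_le_square _ _ Sinf).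
Qed.

Lemma nsub_image_setX (T : choiceType) (U : Type) (Y : set T) (D : set U)
    (F : (T * T) * (T * bool) -> U) :
  infinite_set D -> ~ (D #<= Y) ->
  ~ (D `<=` F @` ((Y `*` Y) `*` (Y `*` [set: bool]))).
Proof.
move=> Dinf nDY /subset_card_le DF.
have {}DF := card_le_trans DF (card_image_le _ _).
have [Yfin|/[dup] Yinf /card_le_square YY] := pselect (finite_set Y).
  by apply: Dinf; apply: (card_le_finite DF); do !apply: finite_setX.
apply: nDY; apply: (card_le_trans DF).
apply: (card_le_trans _ YY); apply: (card_le_setX YY).
exact: card_le_trans (card_le_setX_bool Yinf) YY.
Qed.

Local Open Scope group_scope.

Lemma pick_generic (G : groupType) (c : G) (Y : set G) :
    infinite_set [set: G] -> ~ ([set: G] #<= Y) ->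
  exists x, forall u v y, Y u -> Y v -> Y y ->
    x != u * v^-1 * y /\ c * x != u * v^-1 * y.
Proof.
move=> Ginf Ysmall.
(* The flag tells whether [x] itself must avoid [z], or [c * x] must, that is, [x] must avoid
   [c^-1 * z]. *)
pose F (p : (G * G) * (G * bool)) :=
  let z := p.1.1 * p.1.2^-1 * p.2.1 in if p.2.2 then z else c^-1 * z.
have /existsNP[x nx] : ~ (forall x, (F @` ((Y `*` Y) `*` (Y `*` [set: bool]))) x).
  by move=> FT; apply: (nsub_image_setX _ _ Y setT F).
exists x => u v y Yu Yv Yy; split; apply/eqP => E; apply: nx => /=.
  by rewrite E; exists ((u, v), (y, true)).
by exists ((u, v), (y, false)) => //; rewrite /F /= -E mulKg.
Qed.

(** * Computing [Delta X] for a generic [f] *)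

Section Delta.
Context {G : groupType} {lt : G -> G -> Prop}.
Hypotheses (lt_trans : forall x y z, lt x y -> lt y z -> lt x z)
  (lt_tri : forall x y, [\/ lt x y, x = y | lt y x]).
Context {A : set G} {g f : G -> G}.
Hypotheses (A1 : A 1) (AV : forall a, A a -> A a^-1) (Ag : forall i, A (g i)).
Let couple i : set G := [set f i; g i * f i].
Hypothesis f_generic : forall i j k l u v y, lt j i -> lt k i -> lt l i ->
  couple j u -> couple k v -> couple l y ->
  f i != u * v^-1 * y /\ g i * f i != u * v^-1 * y.

Let X := [set y | exists i, couple i y].

Let couple_generic i j k l w u v y : couple i w -> lt j i -> lt k i -> lt l i ->
  couple j u -> couple k v -> couple l y -> w <> u * v^-1 * y.
Proof.
move=> iw ji ki li ju kv ly; have [/eqP ? /eqP ?] := f_generic _ _ _ _ _ _ _ ji ki li ju kv ly.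
by case: iw => ->.
Qed.

Lemma generic_inj i j : f i = f j -> i = j.
Proof.
have neq k l : lt k l -> f k <> f l.
  move=> kl fkl; have fk : couple k (f k) by left.
  (* With [u], [v] and [y] all equal to [f k], the forbidden product is [f k] itself. *)
  have [/eqP[]] := f_generic _ _ _ _ _ _ _ kl kl kl fk fk fk.
  by rewrite mulgV mul1g.
by move=> fij; have [/neq[]|//|/neq[]] := lt_tri i j.
Qed.

(** Within one stage the only quotients are [1], [g i] and its inverse; symmetry of [A] covers the
    last. *)
Let couple_quotient i y z : couple i y -> couple i z -> A (z * y^-1).
Proof.
move=> [->|->] [->|->]; rewrite ?mulgV ?mulgK // invgM mulVKg; exact: AV.
Qed.

Lemma Delta_generic : (forall a, A a -> infinite_set (g @^-1` [set a])) -> Delta X = A.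
Proof.
move=> g_inf; apply/seteqP; split=> a; last first.
  move=> Aa; rewrite /Delta /=.
  have : infinite_set ((fun i => a * f i) @` (g @^-1` [set a])).
    apply: contra_not (g_inf _ Aa) => fin.
    apply: (card_le_finite _ fin); apply: (card_le_inj (fun i => a * f i)).
      by move=> i gi; exists i.
    by move=> i j _ _ /mulgI /generic_inj.
  apply: sub_infinite_set => _ [i gi <-]; split.
    by exists (f i) => //; exists i; left.
  by exists i; right; rewrite gi.
move=> a_inf; apply: contrapT => nAa; apply: a_inf.
(* A common stage for [y] and [a * y] would put their quotient [a] in [A]. *)
have stages y i j : couple i (a * y) -> couple j y -> lt i j \/ lt j i.
  move=> ia jy; have [ij|eij|ji] := lt_tri i j; [by left| |by right].
  by case: nAa; rewrite -(mulgK y a); rewrite eij in ia; exact: couple_quotient jy ia.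
(* [at_stage i y]: the later of the stages at which [y] and [a * y] enter [X] is
   [i]. Genericity makes this stage unique, since a quotient of earlier elements
   cannot be created again; so only the elements of [couple i] can be involved. *)
pose at_stage i y := couple i (a * y) /\ (exists2 j, lt j i & couple j y) \/
  couple i y /\ (exists2 j, lt j i & couple j (a * y)).
have staged y : X y -> X (a * y) -> exists i, at_stage i y.
  move=> [j jy] [i iay]; have [ij|ji] := stages _ _ _ iay jy.
    by exists j; right; split=> //; exists i.
  by exists i; left; split=> //; exists j.
have stage_uniq i i' y y' : lt i i' -> at_stage i y -> at_stage i' y' -> False.
  move=> ii' iy iy'.
  have [j [k [ji' ki' jay ky]]] : exists j k,
      [/\ lt j i', lt k i', couple j (a * y) & couple k y].
    case: iy => -[iy [j ji jy]]; [exists i, j|exists j, i]; split=> //; exact: lt_trans ii'.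
  (* As [a = (a * y) * y^-1], the new element is [a * y' = (a * y) * y^-1 * y'] or
     [y' = y * (a * y)^-1 * (a * y')], both forbidden at stage [i']. *)
  case: iy' => -[new [l li' old]].
    apply: (couple_generic _ _ _ _ _ _ _ _ new ji' ki' li' jay ky old).
    by rewrite mulgK.
  apply: (couple_generic _ _ _ _ _ _ _ _ new ki' ji' li' ky jay old).
  by rewrite invgM !mulgA mulgV mul1g mulVg mul1g.
have [[y0 [i0 y0P]]|nex] := pselect (exists y i, at_stage i y); last first.
  apply: (sub_finite_set _ (finite_set0 _)) => _ [[y Xy <-] Xay].
  by case: nex; exists y; apply: staged.
(* The later element is [a * y] or [y], so [a * y] lies in [couple i0] or in its translate by
   [a]. *)
apply: (@sub_finite_set _ _ (couple i0 `|` (fun y => a * y) @` couple i0)).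
  move=> _ [[y Xy <-] Xay]; have [i yP] := staged y Xy Xay.
  have ei : i = i0.
    by have [/stage_uniq/(_ yP y0P)|//|/stage_uniq/(_ y0P yP)] := lt_tri i i0.
  by rewrite ei in yP; case: yP => -[iy _]; [left|right; exists y].
by rewrite finite_setU; split; [|apply: finite_image]; apply: finite_set2.
Qed.
End Delta.

(** * The recursion choosing [f] *)

Theorem theorem5p1 (G : groupType) (A : set G)
    (G_infinite : infinite_set [set: G])
    (A_sym : A = set_inv A)
    (A_e : A 1) :
  exists X : set G, Delta X = A.
Proof.
have [lt [lt_wf lt_trans lt_tri seg_small]] := ex_initial_order G.
have [g [gA g_inf]] := ex_infinite_fibers _ _ _ G_infinite A_e.
pose couple f i : set G := [set f i; g i * f i].
have [||f fP] := @wf_pick _ _ lt (fun i f x => forall j k l u v y,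
    lt j i -> lt k i -> lt l i -> couple f j u -> couple f k v -> couple f l y ->
    x != u * v^-1 * y /\ g i * x != u * v^-1 * y) 1 lt_wf.
- move=> i f f' ff' x xP j k l u v y ji ki li.
  by rewrite /couple -!ff' //; apply: xP.
- move=> i f.
  (* All elements contributed before stage [i]; initiality of [lt] makes them fewer than [|G|]. *)
  pose Y := (fun p => if p.2 then f p.1 else g p.1 * f p.1) @`
    ([set j | lt j i] `*` [set: bool]).
  have [|x xP] := pick_generic G (g i) Y G_infinite.
    exact: card_nle_image_setX_bool (seg_small i).
  have inY j w : lt j i -> couple f j w -> Y w.
    by move=> ji [->|->]; [exists (j, true)|exists (j, false)].
  exists x => j k l u v y ji ki li ju kv ly.
  by apply: xP; [apply: inY ju|apply: inY kv|apply: inY ly].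
exists [set y | exists i, couple f i y]; apply: (Delta_generic lt_trans lt_tri A_e) => // a Aa.
by rewrite A_sym; exists a.
Qed.
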